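(* Let $R:\mathcal{A}\to[0,\infty]$ be a functional, $S,T:\mathcal{U}\to[0,\infty]$ proper functionals, and $\mathcal{T}$ a topology on $\mathcal{U}$. Consider the properties: (D1) $\mathcal{U}$ is compact with respect to $\mathcal{T}$; (D2) for all sequences $(u_n)_{n\in\mathbb{N}}\subset\mathcal{U}$ converging to $u\in\mathcal{U}$ in the topology $\mathcal{T}$, $S(u)\le\liminf_{n\to\infty}S(u_n)$; (D3) $R(A)=S(\mathbf{1}_A)$ for all $A\in\mathcal{A}$; (D4) $T(u)=\int_0^1R(\{u\ge t\})\,dt$ for all $u\in\mathcal{U}$, and in particular $R(A)=T(\mathbf{1}_A)$ for all $A\in\mathcal{A}$; (D5) $T(u)\le S(u)$ for all $u\in\mathcal{U}$. If (D1) and (D2) hold, then there exists $u\in\operatorname{arg\,min}_{u\in\mathcal{U}}S(u)$. If (D1)–(D5) hold, then for such a minimizer $u$ of $S$ and for Lebesgue almost every $t\in[0,1]$ the set $A_t:=\{u\ge t\}$ satisfies $A_t\in\operatorname{arg\,min}_{A\in\mathcal{A}}R(A)$.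
   Context: $\mathcal{X}$ is a set, $\mathcal{A}\subset2^{\mathcal{X}}$ a $\sigma$-algebra, and $\mathcal{U}:=\{u:\mathcal{X}\to[0,1]\ :\ u\ \mathcal{A}\text{-measurable}\}$. ''Proper'' means not identically $+\infty$.
   Formalization: In (D1), ''compact'' is taken as sequentially compact: with covering compactness the existence claim fails (topology of βN carried over to U). (D4) explicitly includes Lebesgue measurability of t ↦ R({u ≥ t}), and X is nonempty. *)

(* Defs.v *)
From HB Require Import structures.
From mathcomp Require Import all_boot all_order all_algebra.
From mathcomp Require Import all_classical all_reals all_analysis.
From mathcomp Require Import measurable_realfun.

Set Implicit Arguments.
Unset Strict Implicit.
Unset Printing Implicit Defensive.

Import Order.TTheory GRing.Theory Num.Theory.
Import numFieldNormedType.Exports.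

Local Open Scope classical_set_scope.
Local Open Scope ring_scope.

Record topology_on (T : Type) := TopologyOn {
  is_open : set (set T);
  is_openT : is_open setT;
  is_openI : forall A B, is_open A -> is_open B -> is_open (A `&` B);
  is_open_bigcup : forall F : set (set T),
    F `<=` is_open -> is_open (\bigcup_(A in F) A) }.

(* An alias of T, so that a topology bound by a quantifier gives access to the
   library's neighbourhoods and convergence. *)
Definition with_topology (T : choiceType) (tau : topology_on T) : Type := T.

Section with_topology.
Variables (T : choiceType) (tau : topology_on T).

Let op_bigU (I : Type) (f : I -> set T) : (forall i, is_open tau (f i)) ->
  is_open tau (\bigcup_i f i).
Proof.
move=> fop.
have -> : \bigcup_i f i = \bigcup_(A in range f) A by rewrite bigcup_image.
by apply: is_open_bigcup => _ [i _ <-]; exact: fop.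
Qed.

HB.instance Definition _ := Choice.on (with_topology tau).
HB.instance Definition _ := isOpenTopological.Build (with_topology tau)
  (@is_openT _ tau) (@is_openI _ tau) op_bigU.

End with_topology.

(* Covering compactness would not do together with sequential lower
   semicontinuity: in the Stone-Cech compactification of nat, convergent
   sequences are eventually constant, so every function on it is sequentially
   lower semicontinuous, and need not attain its infimum. *)
Definition sequentially_compact (T : topologicalType) : Prop :=
  forall u_ : nat -> T, exists phi : nat -> nat,
    increasing_seq phi /\ exists u : T, u_ \o phi @ \oo --> u.

Definition sequentially_lsc (R : realType) (T : topologicalType)
    (f : T -> \bar R) : Prop :=
  forall (u_ : nat -> T) (u : T), u_ @ \oo --> u ->
    (f u <= limn_einf (f \o u_))%E.

Definition proper_functional (R : realType) (T : Type) (f : T -> \bar R) : Prop :=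
  exists x, f x <> +oo%E.

Definition argmin (R : realType) (T : Type) (D : set T) (f : T -> \bar R) :
    set T :=
  [set x | D x /\ forall y, D y -> (f x <= f y)%E].

Section unit_functions.
Context {d : measure_display} (X : measurableType d) (R : realType).

Definition unit_mfun : set (X -> R) :=
  [set u : X -> R | measurable_fun setT u /\ forall x, 0 <= u x <= 1].

Definition superlevel (u : unit_mfun) (t : R) : set X :=
  [set x | t <= \val u x].

Lemma indic_unit_mfun (A : set X) : measurable A -> unit_mfun (\1_A : X -> R).
Proof.
move=> mA; split; first exact: measurable_indic.
by move=> x; rewrite indicE; case: (x \in A); rewrite /= ?lexx ?ler01.
Qed.

Definition indicator (A : set X) (mA : measurable A) : unit_mfun :=
  exist _ (\1_A : X -> R) (mem_set (indic_unit_mfun mA)).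

End unit_functions.

Arguments unit_mfun {d} X R _.
Arguments indicator {d X} R {A} mA.

(* [0, 1] in the real line equipped with the sigma-algebra of Lebesgue (not only
   Borel) measurable sets, which is the domain of completed_lebesgue_measure. *)
Definition unit_interval {R : realType} :
    set (caratheodory_type (@wlength R idfun)^*%mu) :=
  [set t : R | 0 <= t <= 1].

(* Main.v *)
(** Existence is the direct method. For the second part let [m] be the minimum
    of [S], which is finite. Then [F A = S (\1_A) >= m] for every measurable [A],
    while the average of [t |-> F {u >= t}] over [[0, 1]] is [T u <= S u = m]. A
    function that is at least [m] and has average at most [m] is equal to [m]
    almost everywhere. *)
Require Import Defs.
From HB Require Import structures.
From mathcomp Require Import all_boot all_order all_algebra.
From mathcomp Require Import all_classical all_reals all_analysis.
From mathcomp Require Import measurable_realfun.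

Set Implicit Arguments.
Unset Strict Implicit.
Unset Printing Implicit Defensive.

Import Order.TTheory GRing.Theory Num.Theory.
Import numFieldNormedType.Exports.

Local Open Scope classical_set_scope.
Local Open Scope ereal_scope.

(** Strict growth in [nat] gives [n <= phi n] by induction, so the bound [N] is its own
    threshold. *)
Lemma increasing_seq_cvgny (phi : nat -> nat) :
  increasing_seq phi -> phi @ \oo --> \oo.
Proof.
move=> phi_incr; apply/cvgnyPge => N; exists N => // n /= Nn.
apply: (leq_trans Nn); elim: n {Nn} => // n IHn.
by apply: (leq_ltn_trans IHn); move/increasing_seqP: phi_incr; exact.
Qed.

Lemma sequentially_lsc_argmin (R : realType) (T : topologicalType)
    (f : T -> \bar R) (x0 : T) :
  sequentially_compact T -> sequentially_lsc f -> exists x, argmin setT f x.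
Proof.
move=> Tcompact f_lsc.
(* The point [x0] makes the range nonempty, so some sequence of values tends to the infimum; choice
   lifts it to a minimizing sequence of points. *)
have /ereal_inf_seq[v v_range v_cvg] : range f != set0.
  by apply/set0P; exists (f x0), x0.
have /choice[u uE] : forall n, exists x, f x = v n.
  by move=> n; have [x _ <-] := v_range n; exists x.
have [phi [phi_incr [x u_cvg]]] := Tcompact u.
exists x; split=> // y _; apply: (le_trans (f_lsc _ _ u_cvg)).
have -> : f \o (u \o phi) = v \o phi by apply/funext => n /=; rewrite uE.
(* The subsequence keeps the limit of [v], and a convergent sequence has its limit as lower
   limit. *)
have -> : limn_einf (v \o phi) = ereal_inf (range f).
  suff /cvg_limn_einf_sup[] : v \o phi @ \oo --> ereal_inf (range f) by [].
  exact: cvg_comp (increasing_seq_cvgny phi_incr) v_cvg.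
by apply: ereal_inf_lbound; exists y.
Qed.

(** The function [f - m] is nonnegative and its integral vanishes, hence it is zero almost
    everywhere. Finiteness of [m] allows cancelling it, even where [f] is [+oo]. *)
Lemma ae_eq_ge_integral_le (d : measure_display) (T : measurableType d)
    (R : realType) (mu : {measure set T -> \bar R}%R) (D : set T)
    (f : T -> \bar R) (m : \bar R) :
  measurable D -> measurable_fun D f -> mu D = 1 ->
  m \is a fin_num -> 0 <= m -> (forall x, D x -> m <= f x) ->
  \int[mu]_(x in D) f x <= m ->
  {ae mu, forall x, D x -> f x = m}.
Proof.
move=> mD mf muD m_fin m_ge0 m_le_f int_le.
have g_ge0 x : D x -> 0 <= f x - m by move=> Dx; rewrite sube_ge0 ?m_fin ?m_le_f.
have mg : measurable_fun D (fun x => f x - m).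
  by apply: emeasurable_funB => //; exact: measurable_cst.
(* As [D] has mass 1, [m] is the integral of the constant [m]. Adding it to [f - m] involves
   nonnegative functions alone, so integrability of [f] need not be known. *)
have int_f : \int[mu]_(x in D) f x = \int[mu]_(x in D) (f x - m) + m.
  rewrite -[X in _ + X]mule1 -muD -integral_cst// -ge0_integralD//.
  by apply: eq_integral => x _; rewrite subeK.
have int_g : \int[mu]_(x in D) `|f x - m| = 0.
  transitivity (\int[mu]_(x in D) (f x - m)).
    by apply: eq_integral => x /set_mem Dx; rewrite gee0_abs// g_ge0.
  apply/eqP; rewrite eq_le [X in _ && X]integral_ge0 ?andbT; last exact: g_ge0.
  by move: int_le; rewrite int_f -[leRHS]add0e leeD2rE.
have := (ae_eq_integral_abs mu mD mg).1 int_g.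
apply: filterS => x /[apply] /= fxm.
by rewrite -[f x](subeK _ m_fin) fxm add0e.
Qed.

Lemma measurable_unit_interval (R : realType) : measurable (@unit_interval R).
Proof.
have -> : @unit_interval R = `[0%R, 1%R]%classic.
  by apply/seteqP; split=> t; rewrite /unit_interval /= in_itv.
by apply: sub_caratheodory; exact: (@measurable_itv R).
Qed.

Lemma completed_lebesgue_measure_unit_interval (R : realType) :
  completed_lebesgue_measure (@unit_interval R) = 1.
Proof.
have -> : @unit_interval R = `[0%R, 1%R]%classic.
  by apply/seteqP; split=> t; rewrite /unit_interval /= in_itv.
(* Both measures restrict the same outer measure, so they agree here by conversion. *)
transitivity (lebesgue_measure (`[0%R, 1%R] : set R)%classic) => //.
by rewrite lebesgue_measure_itv /= lte_fin ltr01 oppr0 adde0.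
Qed.

Lemma measurable_superlevel (d : measure_display) (X : measurableType d)
    (R : realType) (u : unit_mfun X R) (t : R) : measurable (superlevel u t).
Proof.
have [mu _] := set_mem (valP u).
have -> : superlevel u t = setT `&` \val u @^-1` `[t, +oo[%classic.
  by rewrite setTI; apply/seteqP; split=> x /=; rewrite in_itv /= andbT.
exact: mu.
Qed.

Theorem mainTheorem13 (R : realType) (d : measure_display)
    (X : measurableType d)
    (F : set X -> \bar R) (S T : unit_mfun X R -> \bar R)
    (tau : topology_on (unit_mfun X R))
    (F_ge0 : forall A, measurable A -> 0 <= F A)
    (S_ge0 : forall u, 0 <= S u) (T_ge0 : forall u, 0 <= T u)
    (S_proper : proper_functional S) (T_proper : proper_functional T) :
  let D1 := sequentially_compact (with_topology tau) in
  let D2 := sequentially_lsc (S : with_topology tau -> \bar R) in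
  let D3 := forall (A : set X) (mA : measurable A), F A = S (indicator R mA) in
  let D4 :=
    (forall u : unit_mfun X R,
       measurable_fun unit_interval (fun t => F (superlevel u t)) /\
       T u = \int[@completed_lebesgue_measure R]_(t in unit_interval)
               F (superlevel u t)) /\
    (forall (A : set X) (mA : measurable A), F A = T (indicator R mA)) in
  let D5 := forall u : unit_mfun X R, T u <= S u in
  (D1 -> D2 -> exists u, argmin setT S u) /\
  (D1 -> D2 -> D3 -> D4 -> D5 ->
     forall u, argmin setT S u ->
       {ae @completed_lebesgue_measure R, forall t, unit_interval t ->
         argmin measurable F (superlevel u t)}).
Proof.
move=> D1 D2 D3 D4 D5; split.
  move=> HD1 HD2; have [u0 _] := S_proper.
  exact: (@sequentially_lsc_argmin R (with_topology tau) S u0 HD1 HD2).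
move=> _ _ HD3 [HD4 _] HD5 u [_ u_min].
have [mF TuE] := HD4 u.
have S_le_F A : measurable A -> S u <= F A.
  by move=> mA; rewrite (HD3 A mA); exact: u_min.
(* Properness supplies a value of [S] other than [+oo], which bounds the minimum. *)
have Su_fin : S u \is a fin_num.
  have [u0 Su0] := S_proper.
  rewrite ge0_fin_numE//; apply: (le_lt_trans (u_min u0 I)).
  by rewrite ltey; exact/eqP.
have : {ae @completed_lebesgue_measure R, forall t, unit_interval t ->
    F (superlevel u t) = S u}.
  apply: ae_eq_ge_integral_le => //.
  - exact: measurable_unit_interval.
  - exact: completed_lebesgue_measure_unit_interval.
  - by move=> t _; apply: S_le_F; exact: measurable_superlevel.
  - by rewrite -TuE; exact: HD5.
(* Since [S u] bounds [F] from below on measurable sets, a superlevel set where [F] takes this value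
   minimizes [F]. *)
apply: filterS => t /[apply] FE.
split; first exact: measurable_superlevel.
by move=> A mA; rewrite FE; exact: S_le_F.
Qed.
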